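(* Suppose the $\mathbb{Z}^d$ system is ergodic and almost surely no walk $X_z$, $z\in\mathcal{W}(\omega)$, has a loop (i.e. $X_z(\omega,i)\ne X_z(\omega,j)$ for $i\neq j$). Then almost surely no two distinct bi-infinite trajectories in $\mathcal{W}$ coalesce, i.e. any two distinct bi-infinite trajectories are disjoint. Consequently, if bi-infinite trajectories exist with positive probability, $d\ge2$, and the walks satisfy the line-crossing assumption (almost surely, for each $z\in\mathcal{W}(\omega)$ and each $a\in\mathbb{Z}$ with $a>z\cdot e_1$ there is $k_0$ such that $X_z(\omega,k_0)\cdot e_1=a$ and $X_z(\omega,k)\cdot e_1>a$ for every $k>k_0$), then we do not have almost sure coalescence.
   Context: $\mathbb{Z}^+=\{0,1,2,\dots\}$. $(\Omega,\mathcal{F},\mathbb{P},\{T^z\}_{z\in\mathbb{Z}^d})$ is a measure-preserving $\mathbb{Z}^d$ action on a probability space. $\mathcal{W}(\omega)\subset\mathbb{Z}^d$ is a measurable random set that is translation covariant, $\mathcal{W}(T^z\omega)=\mathcal{W}(\omega)-z$, with $\mathbb{P}(\mathbf{0}\in\mathcal{W})>0$. For $z\in\mathcal{W}(\omega)$, $X_z(\omega,\cdot):\mathbb{Z}^+\to\mathbb{Z}^d$ is a nearest-neighbor path with $X_z(\omega,0)=z$, measurable in $\omega$. Almost surely, for all $z\in\mathcal{W}(\omega)$, $x\in\mathbb{Z}^d$, $k\in\mathbb{Z}^+$, the walks are stationary, $X_z(\omega,k)=x+X_{z-x}(T^x\omega,k)$, and compatible, $X_z(\omega,k+1)=X_{X_z(\omega,1)}(\omega,k)$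 (in particular $X_z(\omega,1)\in\mathcal{W}(\omega)$). Points $x,y\in\mathcal{W}(\omega)$ coalesce if $X_x(\omega,k_0)=X_y(\omega,k_1)$ for some $k_0,k_1\in\mathbb{Z}^+$. We have almost sure coalescence if almost surely all pairs $x,y\in\mathcal{W}(\omega)$ coalesce. A point $z$ is bi-infinite if there is a sequence $(a_n)_{n\ge0}$ in $\mathcal{W}(\omega)$ with $a_0=z$ and $X_{a_n}(\omega,i)=a_{n-i}$ for all $n\ge 1$, $0\le i\le n$. The union $\bigcup_{n}\bigcup_{i\ge0}\{X_{a_n}(\omega,i)\}\subset\mathbb{Z}^d$ is called a bi-infinite trajectory. Two distinct bi-infinite trajectories coalesce if they have a point in common. *)

(* Defs.v *)
From HB Require Import structures.
From mathcomp Require Export all_boot all_order all_algebra.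
From mathcomp Require Export all_classical all_reals all_analysis.

Set Implicit Arguments.
Unset Strict Implicit.
Unset Printing Implicit Defensive.

Import Order.TTheory GRing.Theory Num.Theory.
Local Open Scope classical_set_scope.
Local Open Scope ring_scope.

Section System.
Context {disp : measure_display} {Omega : measurableType disp} {R : realType}.
Variables (P : probability Omega R) (d : nat).
Variable T : 'rV[int]_d -> Omega -> Omega.
Variable W : Omega -> set 'rV[int]_d.
(* X w z k is the position at time k of the walk started at z; it is
   meaningful only when z belongs to W w. *)
Variable X : Omega -> 'rV[int]_d -> nat -> 'rV[int]_d.

Record mp_action : Prop := {
  mp_action0 : forall w, T 0 w = w;
  mp_actionD : forall y z w, T (y + z) w = T y (T z w);
  mp_action_measurable : forall z, measurable_fun setT (T z);
  mp_action_preserves :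
    forall z (A : set Omega), measurable A -> P (T z @^-1` A) = P A
}.

Definition ergodic : Prop :=
  forall A : set Omega, measurable A ->
    (forall z, T z @^-1` A = A) -> P A = 0%E \/ P A = 1%E.

(* l1-distance one *)
Definition nearest_neighbor (x y : 'rV[int]_d) : Prop :=
  \sum_(i < d) `|(y - x) 0 i| = 1.

(* Measurability of W and X is with respect to the discrete sigma-algebra on
   the countable lattice, the domain of X _ z k being the event that z is in
   W. *)
Record walk_system : Prop := {
  walk_W_measurable : forall z, measurable [set w | W w z];
  walk_W_covariant : forall z w, W (T z w) = [set y - z | y in W w];
  walk_W_pos : (0 < P [set w | W w 0%R])%E;
  walk_X_measurable :
    forall z k y, measurable [set w | W w z /\ X w z k = y];
  walk_X_start : forall w z, W w z -> X w z 0%N = z;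
  walk_X_nearest_neighbor :
    forall w z, W w z -> forall k, nearest_neighbor (X w z k) (X w z k.+1);
  walk_X_stationary :
    {ae P, forall w, forall z, W w z ->
      forall (x : 'rV[int]_d) k, X w z k = x + X (T x w) (z - x) k};
  walk_X_compatible :
    {ae P, forall w, forall z, W w z ->
      W w (X w z 1%N) /\ forall k, X w z k.+1 = X w (X w z 1%N) k}
}.

Definition no_loops : Prop :=
  {ae P, forall w, forall z, W w z ->
    forall i j : nat, i <> j -> X w z i <> X w z j}.

Definition coalesce (w : Omega) (x y : 'rV[int]_d) : Prop :=
  exists k0 k1 : nat, X w x k0 = X w y k1.

Definition as_coalescence : Prop :=
  {ae P, forall w, forall x y, W w x -> W w y -> coalesce w x y}.

Definition ancestral_line (w : Omega) (z : 'rV[int]_d)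
    (a : nat -> 'rV[int]_d) : Prop :=
  [/\ forall n, W w (a n), a 0%N = z &
      forall n i, (1 <= n)%N -> (i <= n)%N -> X w (a n) i = a (n - i)%N].

Definition bi_infinite (w : Omega) (z : 'rV[int]_d) : Prop :=
  exists a, ancestral_line w z a.

Definition trajectory (w : Omega) (a : nat -> 'rV[int]_d) : set 'rV[int]_d :=
  \bigcup_n range (X w (a n)).

Definition bi_infinite_trajectory (w : Omega) (S : set 'rV[int]_d) : Prop :=
  exists z a, ancestral_line w z a /\ S = trajectory w a.

Definition trajectories_coalesce (S S' : set 'rV[int]_d) : Prop :=
  S `&` S' !=set0.

(* Existence of an infinite ancestral line is not an event on the nose; in a
   walk system it differs from one by a null set (each point has finitely many
   ancestors n steps back, so Koenig's lemma applies), and positive probability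
   means that it is not contained in a null event. *)
Definition bi_infinite_trajectories_exist : Prop :=
  ~ P.-negligible [set w | exists S, bi_infinite_trajectory w S].

End System.

(* z 0 0 is the scalar product of z with the first basis vector. *)
Definition line_crossing {disp : measure_display}
    {Omega : measurableType disp} {R : realType} (P : probability Omega R)
    (d : nat) (W : Omega -> set 'rV[int]_d.+1)
    (X : Omega -> 'rV[int]_d.+1 -> nat -> 'rV[int]_d.+1) : Prop :=
  {ae P, forall w, forall z, W w z -> forall a : int, z 0 0 < a ->
    exists k0 : nat, X w z k0 0 0 = a /\
      forall k : nat, (k0 < k)%N -> a < X w z k 0 0}.

(* Main.v *)
(* Call a point deep if it has an n-step ancestor for every n; bi-infinite
   points are deep, and a deep point has a deep predecessor by Koenig's lemma.
   Let every deep point send unit mass to its (deep) successor. By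
   stationarity the expected mass received at a site equals the probability
   that it is deep, so almost surely a deep point has exactly one deep
   predecessor; hence two trajectories with a common point agree backwards
   from it as well.

   Under coalescence any two deep points are then related by descent, so at
   most one deep point on a line orthogonal to e_1 is a last visit to that
   line. When d >= 2 the infinitely many sites of the line are equally likely
   to be it, so there is none, whereas line crossing turns any bi-infinite
   trajectory into such last visits. *)
Require Import Defs.
From mathcomp Require Import lra.
Import Order.TTheory GRing.Theory Num.Theory.

Set Implicit Arguments.
Unset Strict Implicit.
Local Open Scope classical_set_scope.
Local Open Scope ring_scope.

(** * Deterministic part: ancestors and deep points of a compatible family of paths *)

Section Paths.
Variables (V : Type) (D : set V) (x : V -> nat -> V).
Hypothesis x0 : forall z, D z -> x z 0%N = z.
Hypothesis xS : forall z, D z ->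
  D (x z 1%N) /\ forall k, x z k.+1 = x (x z 1%N) k.

(* Unlike "having an infinite ancestral line", this is a countable combination
   of elementary events, hence an event. *)
Definition deep : set V := [set z | forall n, exists2 u, D u & x u n = z].

Lemma path_dom z n : D z -> D (x z n).
Proof.
elim: n z => [|n IHn] z Dz; first by rewrite x0.
by case: (xS Dz) => Dz1 ->; exact: IHn.
Qed.

Lemma path_add z m n : D z -> x z (m + n)%N = x (x z m) n.
Proof.
elim: m z => [|m IHm] z Dz; first by rewrite x0.
by case: (xS Dz) => Dz1 e; rewrite addSn (e m) (e (m + n)%N) IHm.
Qed.

Lemma deep_dom z : deep z -> D z.
Proof. by case/(_ 0%N) => u Du <-; rewrite x0. Qed.

Lemma deep_path z k : deep z -> deep (x z k).
Proof.
move=> Az n; have [u Du <-] := Az n.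
exists (x u k); first exact: path_dom.
by rewrite -!path_add// addnC.
Qed.

Lemma deep_ancestral (a : nat -> V) n :
  (forall n, D (a n)) -> (forall n m, x (a (n + m)%N) m = a n) -> deep (a n).
Proof. by move=> Da e m; exists (a (n + m)%N). Qed.

(* Koenig's lemma, for the finitely many candidate predecessors [s i z]. *)
Lemma deep_predecessor (I : finType) (s : I -> V -> V) z :
  (forall u, D u -> exists i, u = s i (x u 1%N)) ->
  deep z -> exists i, deep (s i z) /\ x (s i z) 1%N = z.
Proof.
move=> sP Az; apply: contrapT => /forallNP noi.
have /choice[h hP] i : exists n,
    ~ exists2 u, D u & x u n = s i z /\ x (s i z) 1%N = z.
  apply: contrapT => /forallNP hi; apply: (noi i); split.
    by move=> n; have /contrapT[u Du [<- _]] := hi n; exists u.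
  by have /contrapT[u _ []] := hi 0%N.
(* [h i] is a depth at which candidate [i] fails. An ancestor of [z] at depth [N.+1] passes, one
   step before [z], through a candidate whose ancestry reaches depth [N], hence [h i]. *)
pose N := (\max_i h i)%N.
have [u Du uz] := Az N.+1.
have xuN : x (x u N) 1%N = z by rewrite -path_add// addn1.
have [i ei] := sP _ (path_dom N Du).
rewrite xuN in ei.
have hN : (h i <= N)%N by exact: leq_bigmax.
apply: (hP i); exists (x u (N - h i)%N); first exact: path_dom.
by rewrite -path_add// subnK// -ei.
Qed.

Hypothesis pred_unique : forall y y',
  deep y -> deep y' -> x y 1%N = x y' 1%N -> y = y'.

(** Successors of deep points are deep, so a merger can be undone one step at a time. *)
Lemma deep_path_inj k y y' :
  deep y -> deep y' -> x y k = x y' k -> y = y'.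
Proof.
elim: k y y' => [|k IHk] y y' Ay Ay'.
  by rewrite !x0//; exact: deep_dom.
have [_ ->] := xS (deep_dom Ay); have [_ ->] := xS (deep_dom Ay').
by move=> /(IHk _ _ (deep_path 1 Ay) (deep_path 1 Ay')); exact: pred_unique.
Qed.

(* Both trajectories can be followed back from the common point by the same
   number of steps, as far as one likes, and then reach the same ancestor. *)
Lemma ancestral_union_sub (a a' : nat -> V) n m i j :
  (forall n, D (a n)) -> (forall n m, x (a (n + m)%N) m = a n) ->
  (forall n, D (a' n)) -> (forall n m, x (a' (n + m)%N) m = a' n) ->
  x (a n) i = x (a' m) j ->
  \bigcup_n range (x (a n)) `<=` \bigcup_n range (x (a' n)).
Proof.
move=> Da ea Da' ea' e _ [l _ [r _ <-]].
(* Adding [j] and [i] crosswise puts both points [j + l + i] steps before the common point; the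
   extra [l] steps lead back at least to [a l]. *)
have eaa' : a (n + (j + l))%N = a' (m + (i + l))%N.
  apply: (@deep_path_inj (j + l + i)%N); try exact: deep_ancestral.
  rewrite path_add// ea e -(ea' m (i + l)%N) -path_add//.
  by congr (x _ _); rewrite addnC (addnC i) addnA.
exists (m + (i + l))%N => //; exists (n + j + r)%N => //.
by rewrite -eaa' addnA (addnC _ l) path_add// ea.
Qed.

End Paths.

(** * Probability estimates for covers and for disjoint families *)

Section Probability.
Context {disp : measure_display} {Omega : measurableType disp} {R : realType}.
Variable P : probability Omega R.

Lemma le_probability_ae (A B : set Omega) : measurable A -> measurable B ->
  {ae P, forall w, A w -> B w} -> (P A <= P B)%E.
Proof.
move=> mA mB [N [mN N0 AB]].
apply: (@le_trans _ _ (P (B `|` N))).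
  apply: le_measure; rewrite ?inE//; first exact: measurableU.
  move=> w Aw; have [Bw|nBw] := pselect (B w); first by left.
  by right; apply: AB => /(_ Aw).
by rewrite -[leRHS]adde0 -N0; exact: measureU2.
Qed.

Lemma Boole_inequality_ord n (E : 'I_n -> set Omega) :
  (forall i, measurable (E i)) ->
  (P (\big[setU/set0]_(i < n) E i) <= \sum_(i < n) P (E i))%E.
Proof.
(* Measurability is carried through the induction, as subadditivity for two sets requires it. *)
move=> mE; suff: measurable (\big[setU/set0]_(i < n) E i) /\
  (P (\big[setU/set0]_(i < n) E i) <= \sum_(i < n) P (E i))%E by case.
apply: (big_rec2 (fun A r => measurable A /\ (P A <= r)%E)).
  by rewrite measure0; split.
move=> i A r _ [mA Ar]; split; first exact: measurableU.
by apply: (le_trans (measureU2 _ (mE i) mA)); exact: leeD2l.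
Qed.

(* A family covering [G] whose total probability is only [P G] has no room for
   overlaps. *)
Lemma cover_pairwise_null n (E : 'I_n -> set Omega) (G : set Omega) :
  (forall i, measurable (E i)) -> measurable G ->
  {ae P, forall w, G w -> exists i, E i w} ->
  (\sum_(i < n) P (E i) = P G)%E ->
  forall i j, i != j -> P (E i `&` E j) = 0%E.
Proof.
move=> mE mG cover sumE i j ij.
(* Points removed from [E i] stay covered by [E j], so the [F k] still cover [G], while their total
   probability drops by that of the overlap. *)
pose F k := if k == i then E i `\` E j else E k.
have mF k : measurable (F k).
  by rewrite /F; case: ifP => // _; exact: measurableD.
have : (P G <= \sum_(k < n) P (F k))%E.
  apply: le_trans (Boole_inequality_ord mF).
  apply: le_probability_ae => //; first exact: bigsetU_measurable.
  apply: filterS cover => w cw Gw; have [k Ek] := cw Gw.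
  rewrite -bigcup_seq; case: (eqVneq k i) => [ki|ki]; last first.
    by exists k; rewrite /= ?mem_index_enum// /F (negbTE ki).
  have [Ej|nEj] := pselect (E j w).
    by exists j; rewrite /= ?mem_index_enum// /F eq_sym (negbTE ij).
  by exists i; rewrite /= ?mem_index_enum// /F eqxx; split; rewrite // -ki.
rewrite -sumE (bigD1 i)//= [leRHS](bigD1 i)//= {1}/F eqxx.
rewrite [X in (_ <= _ + X)%E](eq_bigr (fun k => P (E k))); last first.
  by move=> k ki; rewrite /F (negbTE ki).
have Sfin : (\sum_(k < n | k != i) P (E k))%E \is a fin_num.
  by apply/sum_fin_numP => k _ _; exact: fin_num_measure.
have -> : P (E i `\` E j) = (P (E i) - P (E i `&` E j))%E.
  by apply: measureD; rewrite -?ge0_fin_numE ?fin_num_measure.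
rewrite leeD2rE//.
have : P (E i) \is a fin_num by exact: fin_num_measure.
have : P (E i `&` E j) \is a fin_num.
  by apply: fin_num_measure; exact: measurableI.
have : (0 <= P (E i `&` E j))%E by [].
case: (P (E i `&` E j)) => // b b0 _; case: (P (E i)) => // a _.
rewrite -EFinB lee_fin => ab; congr EFin.
by move: b0 ab; rewrite lee_fin => b0 ab; lra.
Qed.

(** Off a null set the events are disjoint, so [m] copies of [p] sum to at most 1 for every [m]. *)
Lemma equiprobable_disjoint_null (B : nat -> set Omega) (p : \bar R) :
  (forall k, measurable (B k)) -> (forall k, P (B k) = p) ->
  {ae P, forall w i j, B i w -> B j w -> i = j} -> p = 0%E.
Proof.
move=> mB PB [N [mN N0 disj]].
have mBN k : measurable (B k `\` N) by exact: measurableD.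
have PBN k : P (B k `\` N) = p.
  rewrite -(PB k); apply/eqP; rewrite eq_le; apply/andP; split.
    by apply: le_measure; rewrite ?inE// => w [].
  apply: le_probability_ae => //; exists N; split => // w.
  by apply: contra_notP => nNw Bw; split.
have sum_le m : (\sum_(k < m) p <= 1)%E.
  rewrite -(eq_bigr _ (fun k _ => PBN (nat_of_ord k))).
  rewrite -measure_bigsetU_ord//; last first.
    move=> i j _ _ [w [[Biw nNw] [Bjw _]]]; apply: val_inj => /=.
    by apply: contrapT => ij; apply: nNw; apply: disj => /(_ i j Biw Bjw).
  by apply: probability_le1; exact: bigsetU_measurable.
have : (0 <= p)%E by rewrite -(PB 0%N).
have : p \is a fin_num by rewrite -(PB 0%N) fin_num_measure.
case: p sum_le {PB PBN} => // r sum_le _; rewrite lee_fin => r0.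
congr EFin; apply/eqP; apply: contraT => rN0.
have {}r0 : 0 < r by rewrite lt_neqAle eq_sym rN0.
have := sum_le (Num.bound r^-1); rewrite sumEFin lee_fin sumr_const card_ord.
rewrite leNgt -mulr_natr mulrC -ltr_pdivrMr// div1r.
have /archi_boundP -> // : 0 <= r^-1 by rewrite invr_ge0 ltW.
Qed.

End Probability.

Lemma ae_forall_countable {disp : measure_display} {Omega : measurableType disp}
    {R : realType} (P : probability Omega R) (U : countType)
    (Q : U -> Omega -> Prop) :
  (forall u, {ae P, forall w, Q u w}) -> {ae P, forall w u, Q u w}.
Proof.
move=> aeQ.
have : {ae P, forall w n, if unpickle n is Some u then Q u w else True}.
  apply: ae_foralln => n; case: unpickle => [u|]; first exact: aeQ.
  exact: filterT.
by apply: filterS => w h u; have := h (pickle u); rewrite pickleK.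
Qed.

(* Contains all lattice unit vectors (and more); only finiteness matters. *)
Definition small_step d (i : 'I_#|{ffun 'I_d -> 'I_3}|) : 'rV[int]_d :=
  \row_j ((enum_val i j)%:Z - 1).

Lemma small_step_inj d : injective (@small_step d).
Proof.
move=> i i' /rowP e; apply: enum_val_inj; apply/ffunP => j; apply: val_inj.
by have := e j; rewrite !mxE => /addIr [].
Qed.

Lemma nearest_neighbor_small_step d (x y : 'rV[int]_d) :
  nearest_neighbor x y -> exists i, y - x = small_step i.
Proof.
rewrite /nearest_neighbor; move: (y - x) => v sv.
have v1 j : `|v 0 j| <= 1.
  by rewrite -sv (bigD1 j)//= lerDl sumr_ge0.
(* Each coordinate lies in {-1, 0, 1}; adding 1 makes it an element of ['I_3]. *)
exists (enum_rank [ffun j : 'I_d => inord `|(v 0 j + 1)%R|%N : 'I_3]).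
apply/rowP => j; rewrite !mxE enum_rankK ffunE.
have /andP[l u] : -1 <= v 0 j <= 1 by rewrite -ler_norml.
have p : 0 <= v 0 j + 1 by rewrite -lerBlDr sub0r.
rewrite inordK ?gez0_abs ?addrK//.
by rewrite -ltz_nat gez0_abs// -ltrBrDr (le_lt_trans u).
Qed.

(** * Mass transport: deep points have a unique deep predecessor *)

Section System.
Context {disp : measure_display} {Omega : measurableType disp} {R : realType}.
Variables (P : probability Omega R) (d : nat).
Variable T : 'rV[int]_d -> Omega -> Omega.
Variable W : Omega -> set 'rV[int]_d.
Variable X : Omega -> 'rV[int]_d -> nat -> 'rV[int]_d.
Hypothesis T_action : mp_action P T.
Hypothesis X_walks : walk_system P T W X.

Let deepW w := deep (W w) (X w).

Lemma W_shift z w u : W (T z w) (u - z) <-> W w u.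
Proof.
rewrite (walk_W_covariant X_walks); split; last by exists u.
by move=> [y Wy /addIr <-].
Qed.

Lemma deep_shift z w :
  (forall u, W w u -> forall k, X (T z w) (u - z) k = X w u k - z) ->
  deepW (T z w) 0 <-> deepW w z.
Proof.
move=> Xz; split=> dz n; have [u Wu e] := dz n.
  have Wuz : W w (u + z) by apply/(W_shift z); rewrite addrK.
  exists (u + z) => //; move: e.
  by rewrite -[in X (T z w) u n](addrK z u) Xz// => /subr0_eq.
by exists (u - z); [exact/W_shift|rewrite Xz// e subrr].
Qed.

Lemma walk_start w : forall z, W w z -> X w z 0%N = z.
Proof. by move=> z; exact: (walk_X_start X_walks). Qed.

Lemma deepW_dom w z : deepW w z -> W w z.
Proof. exact: (deep_dom (@walk_start w)). Qed.

Lemma measurable_deep z : measurable [set w | deepW w z].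
Proof.
rewrite (_ : [set w | _] =
    \bigcap_n \bigcup_u [set w | W w u /\ X w u n = z]); last first.
  apply/seteqP; split => w /= h n.
    by move=> _; have [u ? ?] := h n; exists u.
  by have [u _ [? ?]] := h n I; exists u.
apply: bigcapT_measurable => n; apply: countable_bigcupT_measurable => //.
by move=> u; exact: (walk_X_measurable X_walks).
Qed.

Lemma measurable_deep_increment z k v :
  measurable [set w | deepW w z /\ X w z k - z = v].
Proof.
rewrite (_ : [set w | _] =
    [set w | deepW w z] `&` [set w | W w z /\ X w z k = v + z]).
  apply: measurableI (measurable_deep z) _.
  exact: (walk_X_measurable X_walks).
apply/seteqP; split => w /= [dz]; last by case=> _ ->; rewrite addrK.
move=> <-; rewrite subrK; split=> //; split=> //.
exact: deepW_dom.
Qed.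

(** [Q] sees only displacements from the starting point, so by stationarity the event at [z] is, up
    to a null set, the preimage under [T z] of the event at the origin. *)
Lemma deep_probability_shift (Q : (nat -> 'rV[int]_d) -> Prop) :
  (forall z, measurable [set w | deepW w z /\ Q (fun k => X w z k - z)]) ->
  forall z, P [set w | deepW w z /\ Q (fun k => X w z k - z)] =
    P [set w | deepW w 0 /\ Q (fun k => X w 0 k - 0)].
Proof.
move=> mQ z; rewrite -(mp_action_preserves T_action z (mQ 0)).
have mT :
    measurable (T z @^-1` [set w | deepW w 0 /\ Q (fun k => X w 0 k - 0)]).
  by rewrite -[_ @^-1` _]setTI; apply: (mp_action_measurable T_action).
have shift : {ae P, forall w, (deepW w z /\ Q (fun k => X w z k - z)) <->
    (T z @^-1` [set w | deepW w 0 /\ Q (fun k => X w 0 k - 0)]) w}.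
  apply: filterS (walk_X_stationary X_walks) => w st.
  have Xz u : W w u -> forall k, X (T z w) (u - z) k = X w u k - z.
    by move=> Wu k; rewrite (st _ Wu z k) [RHS]addrC addKr.
  have QE : deepW w z ->
      (fun k => X (T z w) 0 k - 0) = (fun k => X w z k - z).
    move=> /deepW_dom Wz.
    by apply/funext => k; rewrite subr0 -Xz// subrr.
  rewrite /preimage/=; split=> [[dz]|[/(deep_shift Xz) dz]]; rewrite QE//.
  by split=> //; exact/(deep_shift Xz).
by apply/eqP; rewrite eq_le; apply/andP; split; apply: le_probability_ae => //;
  apply: filterS shift => w [].
Qed.

Lemma deep_unique_predecessor : {ae P, forall w y y', deepW w y -> deepW w y' ->
  X w y 1%N = X w y' 1%N -> y = y'}.
Proof.
pose step := @small_step d.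
have X1 w y : W w y -> exists i, X w y 1%N - y = step i.
  move=> Wy; have := walk_X_nearest_neighbor X_walks Wy 0.
  by rewrite walk_start//; exact: nearest_neighbor_small_step.
(* [E z i]: mass arrives at [z] along step [i]. Below, [F i]: mass leaves the origin along step
   [i]. *)
pose E z i := [set w | deepW w (z - step i) /\
  X w (z - step i) 1%N - (z - step i) = step i].
have mE z i : measurable (E z i) by exact: measurable_deep_increment.
have XE z i w : X w (z - step i) 1%N = z ->
    X w (z - step i) 1%N - (z - step i) = step i.
  by move=> ->; rewrite opprB addrC subrK.
pose F i := [set w | deepW w 0 /\ X w 0 1%N - 0 = step i].
have mF i : measurable (F i) by exact: measurable_deep_increment.
have trivF : trivIset setT F.
  move=> i j _ _ [w [[_ ei] [_ ej]]].
  by apply: (@small_step_inj d); rewrite -/step -ei -ej.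
have PdeepE z : P [set w | deepW w z] = P [set w | deepW w 0].
  have TE z' : [set w | deepW w z' /\ True] = [set w | deepW w z'].
    by apply/seteqP; split=> w //= [].
  rewrite -!TE; apply: (deep_probability_shift (Q := fun=> True)) => z'.
  by rewrite TE; exact: measurable_deep.
(* Each [E z i] is a translate of [F i], and the [F i] partition the event that the origin is
   deep. *)
have sumE z : (\sum_i P (E z i) = P [set w | deepW w z])%E.
  rewrite PdeepE (eq_bigr (fun i => P (F i))); last first.
    move=> i _; apply: (deep_probability_shift (Q := fun p => p 1%N = step i)).
    by move=> y; exact: (measurable_deep_increment y 1 (step i)).
  rewrite -measure_bigsetU_ord//.
  congr (P _); rewrite -bigcup_seq; apply/seteqP; split => w /=.
    by case=> i _ [].
  move=> dw; have [i ei] := X1 _ _ (deepW_dom dw).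
  by exists i; rewrite /= ?mem_index_enum.
have cover z : {ae P, forall w, deepW w z -> exists i, E z i w}.
  apply: filterS (walk_X_compatible X_walks) => w cw dz.
  have [|i [di ei]] := deep_predecessor (@walk_start w) cw
      (s := fun i u => u - step i) _ dz.
    by move=> u /X1[i ei]; exists i; rewrite /= -ei opprB addrC subrK.
  by exists i; split=> //; exact: XE.
have null : {ae P, forall w (t : 'rV[int]_d * 'I_#|{ffun 'I_d -> 'I_3}| *
    'I_#|{ffun 'I_d -> 'I_3}|),
    t.1.2 != t.2 -> ~ (E t.1.1 t.1.2 `&` E t.1.1 t.2) w}.
  apply: ae_forall_countable => -[[z i] j] /=.
  have [_|ij] := eqVneq i j; first exact: filterE.
  exists (E z i `&` E z j); split; first exact: measurableI.
    exact: (cover_pairwise_null (mE z) (measurable_deep z) (cover z) (sumE z)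
      ij).
  by move=> w /= h; apply: contrapT => h'; exact: h.
apply: filterS null => w nw y y' dy dy' e.
have [i ei] := X1 _ _ (deepW_dom dy).
have [j ej] := X1 _ _ (deepW_dom dy').
have yE : y = X w y 1%N - step i by rewrite -ei opprB addrC subrK.
have y'E : y' = X w y 1%N - step j by rewrite e -ej opprB addrC subrK.
apply: contrapT => yy'; apply: (nw (X w y 1%N, i, j)) => /=.
  by apply: contra_notN yy' => /eqP ij; rewrite yE y'E ij.
by rewrite /E /= -yE -y'E.
Qed.

(** Indexing by [n + m] removes the truncated subtraction. *)
Lemma ancestral_lineE w z a : ancestral_line W X w z a ->
  (forall n, W w (a n)) /\ (forall n m, X w (a (n + m)%N) m = a n).
Proof.
move=> [Wa _ ea]; split=> // n [|m]; first by rewrite walk_start addn0.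
by rewrite ea ?addnK ?leq_addl// addnS.
Qed.

Lemma trajectories_meet_eq : {ae P, forall w S S',
  bi_infinite_trajectory W X w S -> bi_infinite_trajectory W X w S' ->
  trajectories_coalesce S S' -> S = S'}.
Proof.
apply: filterS2 deep_unique_predecessor (walk_X_compatible X_walks).
move=> w uniq cw S S' [z [a [anc ->]]] [z' [a' [anc' ->]]].
move=> [_ [[n _ [i _ <-]] [m _ [j _ e]]]].
have [[Da ea] [Da' ea']] := (ancestral_lineE anc, ancestral_lineE anc').
have sub := ancestral_union_sub (@walk_start w) cw uniq.
by apply/seteqP; split;
  [exact: sub Da ea Da' ea' (esym e)|exact: sub Da' ea' Da ea e].
Qed.

End System.

(** * Last visits to lines, and the failure of coalescence *)

Section LineCrossing.
Context {disp : measure_display} {Omega : measurableType disp} {R : realType}.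
Variables (P : probability Omega R) (d : nat).
Variable T : 'rV[int]_d.+1 -> Omega -> Omega.
Variable W : Omega -> set 'rV[int]_d.+1.
Variable X : Omega -> 'rV[int]_d.+1 -> nat -> 'rV[int]_d.+1.
Hypothesis T_action : mp_action P T.
Hypothesis X_walks : walk_system P T W X.

(* A last visit to a line orthogonal to the first basis vector. *)
Let escapes (p : nat -> 'rV[int]_d.+1) := forall k, 0 < p k.+1 0 0.
Let exit z := [set w | deep (W w) (X w) z /\ escapes (fun k => X w z k - z)].

Lemma measurable_exit z : measurable (exit z).
Proof.
rewrite (_ : exit z = [set w | deep (W w) (X w) z] `&`
    \bigcap_k \bigcup_v (if 0 < (v : 'rV[int]_d.+1) 0 0 then
      [set w | deep (W w) (X w) z /\ X w z k.+1 - z = v] else set0)).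
  apply: measurableI; first exact: (measurable_deep X_walks).
  apply: bigcapT_measurable => k; apply: countable_bigcupT_measurable => // v.
  by case: ifP => // _; exact: (measurable_deep_increment X_walks).
apply/seteqP; split => w [dz ez]; split=> // k.
  by move=> _; exists (X w z k.+1 - z) => //; rewrite (ez k).
by have [v _] := ez k I; case: ifP => // v0 [_ ->].
Qed.

(* Coalescing deep points are equal or one is a descendant of the other. *)
Lemma exit_line_unique : as_coalescence P W X ->
  {ae P, forall w (z z' : 'rV[int]_d.+1), z 0 0 = z' 0 0 ->
    exit z w -> exit z' w -> z = z'}.
Proof.
move=> coal; apply: filterS3 coal (deep_unique_predecessor T_action X_walks)
  (walk_X_compatible X_walks) => w cw uniq comp z z' zz' [dz ez] [dz' ez'].
have start := @walk_start _ _ _ _ _ _ _ _ X_walks w.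
(* The last [k] steps of both paths cancel by injectivity on deep points. *)
have desc y y' k l : deep (W w) (X w) y -> deep (W w) (X w) y' ->
    X w y k = X w y' (l + k)%N -> y = X w y' l.
  move=> dy dy'; rewrite (path_add start comp)//; last exact: deep_dom dy'.
  by apply: (deep_path_inj start comp uniq) => //; exact: deep_path.
(* Here [y] is reached from [y'] in [l - k > 0] steps, so the exit at [y'] would put [y] strictly
   beyond their common line. *)
have no_exit (y y' : 'rV[int]_d.+1) k l :
    y 0 0 = y' 0 0 -> deep (W w) (X w) y ->
    exit y' w -> (k < l)%N -> X w y k = X w y' l -> False.
  move=> yy' dy [dy' ey'] kl e.
  have := ey' (l - k).-1; rewrite prednK ?subn_gt0//.
  rewrite -(desc y y' k) ?subnK ?(ltnW kl)//.
  by rewrite !mxE yy' subrr ltxx.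
have [k [l e]] := cw _ _ (deep_dom start dz) (deep_dom start dz').
have [kl|lk|kl] := ltngtP k l.
- by case: (@no_exit z z' k l).
- by case: (@no_exit z' z l k).
- by apply: (deep_path_inj start comp uniq dz dz' (k := k)); rewrite e kl.
Qed.

Lemma exit_null : (0 < d)%N -> as_coalescence P W X ->
  forall z, P (exit z) = 0%E.
Proof.
move=> d0 coal z.
have PE y : P (exit y) = P (exit 0).
  exact: (deep_probability_shift T_action X_walks (Q := escapes)
    measurable_exit).
(* Multiples of the last basis vector have first coordinate 0, since [0 < d] separates [ord_max]
   from [0]. *)
pose line k : 'rV[int]_d.+1 := k%:Z *: delta_mx 0 ord_max.
rewrite PE; apply: (@equiprobable_disjoint_null _ _ _ P (exit \o line)) => //.
- by move=> k; exact: measurable_exit.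
- by move=> k; exact: PE.
apply: filterS (exit_line_unique coal) => w uniq i j ei ej.
have /uniq/(_ ei ej) : line i 0 0 = line j 0 0.
  have N0 : (0 == ord_max :> 'I_d.+1) = false by apply: ltn_eqF.
  by rewrite !mxE N0 andbF !mulr0.
by move/rowP/(_ ord_max); rewrite !mxE !eqxx !mulr1 => -[].
Qed.

Lemma coalescence_no_bi_infinite_trajectory : (0 < d)%N ->
  line_crossing P W X -> as_coalescence P W X ->
  P.-negligible [set w | exists S, bi_infinite_trajectory W X w S].
Proof.
move=> d0 cross coal.
have noexit : {ae P, forall w z, ~ exit z w}.
  apply: ae_forall_countable => z; exists (exit z); split.
  - exact: measurable_exit.
  - exact: exit_null.
  - by move=> w; apply: contra_notP.
have : {ae P, forall w, ~ exists S, bi_infinite_trajectory W X w S}.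
  apply: filterS3 noexit cross (walk_X_compatible X_walks).
  move=> w noexit_w cross_w comp [_ [z [a [anc _]]]].
  have start := @walk_start _ _ _ _ _ _ _ _ X_walks w.
  have [Da ea] := ancestral_lineE X_walks anc.
  have da : deep (W w) (X w) (a 0%N) by exact: deep_ancestral.
  (* The next line is used because the crossing assumption concerns only lines strictly ahead; the
     last visit [k0] to it gives a deep exit point. *)
  have [|k0 [ek0 gk0]] := cross_w _ (Da 0%N) (a 0%N 0 0 + 1).
    by rewrite ltrDl.
  apply: (noexit_w (X w (a 0%N) k0)); split; first exact: deep_path.
  move=> k; rewrite -(path_add start comp)// !mxE ek0 subr_gt0.
  by apply: gk0; rewrite addnS ltnS leq_addr.
by apply: negligibleS => w /= h; apply.
Qed.

End LineCrossing.

Theorem theorem2p9 (disp : measure_display) (Omega : measurableType disp)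
  (R : realType) (P : probability Omega R) (d : nat)
  (T : 'rV[int]_d.+1 -> Omega -> Omega)
  (W : Omega -> set 'rV[int]_d.+1)
  (X : Omega -> 'rV[int]_d.+1 -> nat -> 'rV[int]_d.+1)
  (T_action : mp_action P T)
  (X_walks : walk_system P T W X)
  (T_ergodic : ergodic P T)
  (X_no_loops : no_loops P W X) :
  {ae P, forall w, forall S S' : set 'rV[int]_d.+1,
    bi_infinite_trajectory W X w S -> bi_infinite_trajectory W X w S' ->
    S <> S' -> ~ trajectories_coalesce S S'} /\
  (bi_infinite_trajectories_exist P W X -> (2 <= d.+1)%N ->
   line_crossing P W X -> ~ as_coalescence P W X).
Proof.
split.
  apply: filterS (trajectories_meet_eq T_action X_walks) => w eqS S S' bS bS'.
  by apply: contra_not; exact: eqS.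
move=> ex d1 cross coal; apply: ex.
exact: (coalescence_no_bi_infinite_trajectory T_action X_walks).
Qed.
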